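(* The ring $\widetilde B$ is not a domain. In particular, in $\widetilde B$, $$0=y_0^2+y_1^2+y_2^2+y_3^2=(y_0-y_1-y_2-y_3)^2=(y_0-y_1+y_2+y_3)^2=(y_0+y_1-y_2+y_3)^2=(y_0+y_1+y_2-y_3)^2.$$
   Context: Let $k$ be an algebraically closed field of characteristic not $2$, and let $\alpha_1,\alpha_2,\alpha_3\in k$ satisfy $\alpha_1+\alpha_2+\alpha_3+\alpha_1\alpha_2\alpha_3=0$ and $\{\alpha_1,\alpha_2,\alpha_3\}\cap\{0,1,-1\}=\varnothing$. Let $Q$ be the quotient of the free algebra $k\langle x_0,x_1,x_2,x_3\rangle$ (graded, $\deg x_j=1$) by the six relations $x_0x_i-x_ix_0=\alpha_i(x_jx_k+x_kx_j)$, $x_0x_i+x_ix_0=x_jx_k-x_kx_j$, $(i,j,k)$ running over the cyclic permutations of $(1,2,3)$. The elements $\Omega=-x_0^2+x_1^2+x_2^2+x_3^2$ and $\Omega'=x_1^2+\frac{1+\alpha_1}{1-\alpha_2}x_2^2+\frac{1-\alpha_1}{1+\alpha_3}x_3^2$ of $Q$ are central; $B=Q/(\Omega,\Omega')$. The group $\Gamma=\{1,\gamma_1,\gamma_2,\gamma_3=\gamma_1\gamma_2\}\cong\mathbb Z/2\times\mathbb Z/2$ acts on $Q$ and $B$ by: $\gamma_i$ fixes $x_0,x_i$ and negates $x_j$ for $j\in\{1,2,3\}\setminus\{i\}$. It acts on $M_2(k)$ by $\gamma_j(a)=q_jaq_j^{-1}$ where, with $i^2=-1$, $q_1=\begin{pmatrix}i&0\\0&-i\end{pmatrix}$,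 $q_2=\begin{pmatrix}0&i\\i&0\end{pmatrix}$, $q_3=\begin{pmatrix}0&-1\\1&0\end{pmatrix}$. Put $\widetilde B=(B\otimes M_2(k))^\Gamma$ (diagonal action), and let $y_0=x_0\otimes 1$, $y_j=x_j\otimes q_j$ for $j=1,2,3$, viewed as elements of $\widetilde B$. *)

(* Defs.v *)
From HB Require Import structures.
From mathcomp Require Import all_fingroup.
From mathcomp Require Import all_boot all_order all_algebra.
From mathcomp Require Import finmap boolp.
From mathcomp.multinomials Require Import monalg.

Set Implicit Arguments.
Unset Strict Implicit.
Unset Printing Implicit Defensive.

Import GRing.Theory.
Local Open Scope ring_scope.
Local Open Scope quotient_scope.

(* k<x_0, ..., x_(n-1)>, as the monoid algebra of the free monoid on 'I_n *)
Definition free_alg (k : fieldType) (n : nat) := {malg k[{fmonom 'I_n}]}.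

HB.instance Definition _ (k : fieldType) (n : nat) :=
  GRing.Lalgebra.on (free_alg k n).

Section FreeAlgebra.
Variables (k : fieldType) (n : nat).
Local Notation F := (free_alg k n).

Definition free_gen (j : 'I_n) : F := << fmu j >>.

Lemma free_scaleAr (c : k) (u v : F) : c *: (u * v) = u * (c *: v).
Proof.
have comC : (c%:MP : {malg k[{fmonom 'I_n}]}) * u = u * c%:MP.
  rewrite !malgM_def fgmulgU fgmulUg; apply: eq_bigr => m _.
  by rewrite mulm1 mul1m mulrC.
have swap (R : nzRingType) (a b d : R) : a * b = b * a -> a * (b * d) = b * (a * d).
  by move=> ab; rewrite mulrA ab mulrA.
have := swap _ _ _ v comC.
by rewrite !mul_malgC.
Qed.

HB.instance Definition _ :=
  GRing.Lalgebra_isAlgebra.Build k (free_alg k n) free_scaleAr.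

Variables (A : algType k) (v : 'I_n -> A).

Definition fmonom_eval (m : {fmonom 'I_n}) : A := \prod_(j <- (m : seq 'I_n)) v j.

Lemma fmonom_eval_mmorphism : mmorphism fmonom_eval.
Proof.
split=> [m1 m2|]; first by rewrite /fmonom_eval fmM big_cat.
by rewrite /fmonom_eval fm1 big_nil.
Qed.

HB.instance Definition _ :=
  monalg.isMultiplicative.Build {fmonom 'I_n} A fmonom_eval
    fmonom_eval_mmorphism.

Definition free_lift : F -> A := mmap (in_alg A) fmonom_eval.

Lemma free_lift_zmod_morphism : zmod_morphism free_lift.
Proof. by move=> x y; apply: (raddfB (mmap (in_alg A) fmonom_eval)). Qed.

Lemma free_lift_monoid_morphism : monoid_morphism free_lift.
Proof.
have [M o] : GRing.multiplicative free_lift.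
  apply: commr_mmap_is_multiplicative => g m m'.
  by rewrite /GRing.comm mulr_algl mulr_algr.
by split.
Qed.

Lemma free_lift_scalable : scalable free_lift.
Proof. by move=> c x; rewrite /free_lift mmapZ mulr_algl. Qed.

HB.instance Definition _ :=
  GRing.isZmodMorphism.Build F A free_lift free_lift_zmod_morphism.
HB.instance Definition _ :=
  GRing.isMonoidMorphism.Build F A free_lift free_lift_monoid_morphism.
HB.instance Definition _ :=
  GRing.isScalable.Build k F A *:%R free_lift free_lift_scalable.

Lemma free_lift_gen j : free_lift (free_gen j) = v j.
Proof. by rewrite /free_lift mmapU /= scale1r mul1r /fmonom_eval fmU big_seq1. Qed.

End FreeAlgebra.

Lemma free_algE (k : fieldType) (n : nat) (x : free_alg k n) :
  x = \sum_(m <- msupp x) x@_m *: \prod_(j <- (m : seq 'I_n)) free_gen k j.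
Proof.
rewrite [LHS]monalgE; apply: eq_bigr => m _.
suff -> : \prod_(j <- (m : seq 'I_n)) free_gen k j
    = << m >> :> {malg k[{fmonom 'I_n}]}.
  by rewrite -mul_malgC malgM_def fgmulUU mulr1 mul1m.
case: m => s; elim: s => [|j s IHs] /=.
  rewrite big_nil; congr (<< 1 *g _ >>); apply/eqP.
  by rewrite fmP fm1.
rewrite big_cons IHs; transitivity (fgmul << fmu j >> << FMonom s >> : {malg k[{fmonom 'I_n}]}) => //.
rewrite fgmulUU mulr1; congr (<< 1 *g _ >>); apply/eqP.
by rewrite fmP fmM fmU.
Qed.

Lemma free_alg_ext (k : fieldType) (n : nat) (A : algType k)
    (f g : {lrmorphism free_alg k n -> A}) :
  (forall j, f (free_gen k j) = g (free_gen k j)) -> f =1 g.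
Proof.
move=> fg x; rewrite [x]free_algE !linear_sum; apply: eq_bigr => m _.
by rewrite !linearZ !rmorph_prod /=; congr (_ *: _); apply: eq_bigr => j _.
Qed.

Section IdealGenerated.
Variables (R : nzRingType) (r : seq R).

Inductive ideal_gen : R -> Prop :=
| IdealGen x of x \in r : ideal_gen x
| Ideal0 : ideal_gen 0
| IdealD x y of ideal_gen x & ideal_gen y : ideal_gen (x + y)
| IdealMl a x of ideal_gen x : ideal_gen (a * x)
| IdealMr a x of ideal_gen x : ideal_gen (x * a).

Lemma ideal_genN x : ideal_gen x -> ideal_gen (- x).
Proof. by rewrite -mulN1r; apply: IdealMl. Qed.

Lemma ideal_genB x y : ideal_gen x -> ideal_gen y -> ideal_gen (x - y).
Proof. by move=> Ix Iy; apply: IdealD => //; apply: ideal_genN. Qed.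

Definition ideal_equiv (x y : R) : bool := `[< ideal_gen (x - y) >].

Lemma ideal_equiv_is_equiv : equiv_class_of ideal_equiv.
Proof.
split=> [x|x y|y x z]; rewrite /ideal_equiv.
- by apply/asboolP; rewrite subrr; apply: Ideal0.
- by apply/asboolP/asboolP => /ideal_genN; rewrite opprB.
- move=> /asboolP Ixy /asboolP Iyz; apply/asboolP.
  by rewrite -[x - z](subrKA y); apply: IdealD.
Qed.

Canonical ideal_equiv_equiv := EquivRelPack ideal_equiv_is_equiv.
Canonical ideal_equiv_encModRel := defaultEncModRel ideal_equiv.

End IdealGenerated.

Lemma ideal_gen_morph (R S : nzRingType) (r : seq R) (f : {rmorphism R -> S}) x :
  {in r, forall z, f z = 0} -> ideal_gen r x -> f x = 0.
Proof.
move=> f0; elim=> {x} [x /f0 //||x y _ fx _ fy|a x _ fx|a x _ fx].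
- exact: rmorph0.
- by rewrite rmorphD fx fy addr0.
- by rewrite rmorphM fx mulr0.
- by rewrite rmorphM fx mul0r.
Qed.

(* An algType is a nonzero ring, hence the properness of the ideal as an
   argument of the type of A/(r). *)
Definition quot_alg (k : fieldType) (A : algType k) (r : seq A)
    (Hr : ~ ideal_gen r 1) := {eq_quot ideal_equiv r}.

Section QuotientAlgebra.
Variables (k : fieldType) (A : algType k) (r : seq A) (Hr : ~ ideal_gen r 1).
Local Notation Q := (quot_alg Hr).

HB.instance Definition _ : EqQuotient A (ideal_equiv r) Q :=
  EqQuotient.on (quot_alg Hr).
HB.instance Definition _ := Choice.on Q.

Definition quot_pi (x : A) : Q := \pi_Q x.

Lemma quot_piP x y : reflect (quot_pi x = quot_pi y) `[< ideal_gen r (x - y) >].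
Proof. by rewrite /quot_pi; apply: (@eqquotP _ _ Q x y). Qed.

Lemma quot_pi_eq x y : ideal_gen r (x - y) -> quot_pi x = quot_pi y.
Proof. by move=> Ixy; apply/quot_piP/asboolP. Qed.

Lemma quot_piI x y : quot_pi x = quot_pi y -> ideal_gen r (x - y).
Proof. by move/quot_piP/asboolP. Qed.

Lemma quot_reprK z : quot_pi (repr z) = z.
Proof. exact: reprK. Qed.

Lemma quot_repr x : ideal_gen r (repr (quot_pi x) - x).
Proof. by apply: quot_piI; rewrite quot_reprK. Qed.

Definition quot_add (u v : Q) : Q := quot_pi (repr u + repr v).
Definition quot_opp (u : Q) : Q := quot_pi (- repr u).
Definition quot_mul (u v : Q) : Q := quot_pi (repr u * repr v).
Definition quot_scale (c : k) (u : Q) : Q := quot_pi (c *: repr u).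

Lemma quot_piD x y : quot_add (quot_pi x) (quot_pi y) = quot_pi (x + y).
Proof.
apply: quot_pi_eq; rewrite opprD addrACA.
by apply: IdealD; apply: quot_repr.
Qed.

Lemma quot_piN x : quot_opp (quot_pi x) = quot_pi (- x).
Proof. by apply: quot_pi_eq; rewrite -opprD; apply/ideal_genN/quot_repr. Qed.

Lemma quot_piM x y : quot_mul (quot_pi x) (quot_pi y) = quot_pi (x * y).
Proof.
apply: quot_pi_eq; set x' := repr _; set y' := repr _.
have -> : x' * y' - x * y = (x' - x) * y' + x * (y' - y).
  by rewrite mulrBl mulrBr addrA subrK.
by apply: IdealD; [apply/IdealMr/quot_repr | apply/IdealMl/quot_repr].
Qed.

Lemma quot_piZ c x : quot_scale c (quot_pi x) = quot_pi (c *: x).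
Proof.
apply: quot_pi_eq; rewrite -scalerBr -mulr_algl.
exact/IdealMl/quot_repr.
Qed.

Lemma quot_ind (P : Q -> Prop) : (forall x, P (quot_pi x)) -> forall u, P u.
Proof. by move=> HP u; rewrite -[u]quot_reprK. Qed.

Lemma quot_addA : associative quot_add.
Proof.
by elim/quot_ind=> x; elim/quot_ind=> y; elim/quot_ind=> z; rewrite !quot_piD addrA.
Qed.

Lemma quot_addC : commutative quot_add.
Proof. by elim/quot_ind=> x; elim/quot_ind=> y; rewrite !quot_piD addrC. Qed.

Lemma quot_add0 : left_id (quot_pi 0) quot_add.
Proof. by elim/quot_ind=> x; rewrite quot_piD add0r. Qed.

Lemma quot_addN : left_inverse (quot_pi 0) quot_opp quot_add.
Proof. by elim/quot_ind=> x; rewrite quot_piN quot_piD addNr. Qed.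

HB.instance Definition _ :=
  GRing.isZmodule.Build Q quot_addA quot_addC quot_add0 quot_addN.

Lemma quot_mulA : associative quot_mul.
Proof.
by elim/quot_ind=> x; elim/quot_ind=> y; elim/quot_ind=> z; rewrite !quot_piM mulrA.
Qed.

Lemma quot_mul1 : left_id (quot_pi 1) quot_mul.
Proof. by elim/quot_ind=> x; rewrite quot_piM mul1r. Qed.

Lemma quot_mulr1 : right_id (quot_pi 1) quot_mul.
Proof. by elim/quot_ind=> x; rewrite quot_piM mulr1. Qed.

Lemma quot_mulDl : left_distributive quot_mul +%R.
Proof.
elim/quot_ind=> x; elim/quot_ind=> y; elim/quot_ind=> z.
by rewrite /GRing.add /= !(quot_piM, quot_piD) mulrDl.
Qed.

Lemma quot_mulDr : right_distributive quot_mul +%R.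
Proof.
elim/quot_ind=> x; elim/quot_ind=> y; elim/quot_ind=> z.
by rewrite /GRing.add /= !(quot_piM, quot_piD) mulrDr.
Qed.

Lemma quot_oner_neq0 : quot_pi 1 != 0.
Proof. by apply/eqP => /quot_piI; rewrite subr0. Qed.

HB.instance Definition _ := GRing.Zmodule_isNzRing.Build Q
  quot_mulA quot_mul1 quot_mulr1 quot_mulDl quot_mulDr quot_oner_neq0.

Lemma quot_scaleA a b u : quot_scale a (quot_scale b u) = quot_scale (a * b) u.
Proof. by elim/quot_ind: u => x; rewrite !quot_piZ scalerA. Qed.

Lemma quot_scale1 : left_id 1 quot_scale.
Proof. by elim/quot_ind=> x; rewrite !quot_piZ scale1r. Qed.

Lemma quot_scaleDr : right_distributive quot_scale +%R.
Proof.
move=> c; elim/quot_ind=> x; elim/quot_ind=> y.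
by rewrite /GRing.add /= !(quot_piZ, quot_piD) scalerDr.
Qed.

Lemma quot_scaleDl u : {morph quot_scale^~ u : a b / a + b}.
Proof.
move=> a b; elim/quot_ind: u => x.
by rewrite [in RHS]/GRing.add /= !(quot_piZ, quot_piD) scalerDl.
Qed.

HB.instance Definition _ := GRing.Zmodule_isLmodule.Build k Q
  quot_scaleA quot_scale1 quot_scaleDr quot_scaleDl.

Lemma quot_scaleAl (c : k) (u v : Q) : c *: (u * v) = (c *: u) * v.
Proof.
elim/quot_ind: u => x; elim/quot_ind: v => y.
by rewrite /GRing.mul /GRing.scale /= !(quot_piZ, quot_piM) scalerAl.
Qed.

HB.instance Definition _ := GRing.Lmodule_isLalgebra.Build k Q quot_scaleAl.

Lemma quot_scaleAr (c : k) (u v : Q) : c *: (u * v) = u * (c *: v).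
Proof.
elim/quot_ind: u => x; elim/quot_ind: v => y.
by rewrite /GRing.mul /GRing.scale /= !(quot_piZ, quot_piM) scalerAr.
Qed.

HB.instance Definition _ := GRing.Lalgebra_isAlgebra.Build k Q quot_scaleAr.

Lemma quot_pi_zmod_morphism : zmod_morphism quot_pi.
Proof. by move=> x y; rewrite -quot_piD -quot_piN. Qed.

Lemma quot_pi_monoid_morphism : monoid_morphism quot_pi.
Proof. by split=> // x y; rewrite -quot_piM. Qed.

Lemma quot_pi_scalable : scalable quot_pi.
Proof. by move=> c x; rewrite -quot_piZ. Qed.

HB.instance Definition _ :=
  GRing.isZmodMorphism.Build A Q quot_pi quot_pi_zmod_morphism.
HB.instance Definition _ :=
  GRing.isMonoidMorphism.Build A Q quot_pi quot_pi_monoid_morphism.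
HB.instance Definition _ :=
  GRing.isScalable.Build k A Q *:%R quot_pi quot_pi_scalable.

Lemma quot_pi_eq0 x : (quot_pi x = 0) <-> ideal_gen r x.
Proof.
split=> [E|Ix]; last by apply: quot_pi_eq; rewrite subr0.
by rewrite -[x]subr0; apply: quot_piI.
Qed.

Section Lift.
Variables (C : algType k) (f : {lrmorphism A -> C}).
Hypothesis f0 : {in r, forall x, f x = 0}.

Definition quot_lift of {in r, forall x, f x = 0} := fun u : Q => f (repr u).
Local Notation fq := (quot_lift f0).

Lemma quot_lift_pi x : fq (quot_pi x) = f x.
Proof.
apply/eqP; rewrite -subr_eq0 -rmorphB.
by apply/eqP/(ideal_gen_morph f0)/quot_repr.
Qed.

Lemma quot_lift_zmod_morphism : zmod_morphism fq.
Proof.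
elim/quot_ind=> x; elim/quot_ind=> y.
by rewrite -rmorphB !quot_lift_pi rmorphB.
Qed.

Lemma quot_lift_monoid_morphism : monoid_morphism fq.
Proof.
split; first by rewrite -(rmorph1 quot_pi) quot_lift_pi rmorph1.
elim/quot_ind=> x; elim/quot_ind=> y.
by rewrite -rmorphM !quot_lift_pi rmorphM.
Qed.

Lemma quot_lift_scalable : scalable fq.
Proof.
move=> c; elim/quot_ind=> x.
by rewrite -linearZ !quot_lift_pi linearZ.
Qed.

HB.instance Definition _ :=
  GRing.isZmodMorphism.Build Q C fq quot_lift_zmod_morphism.
HB.instance Definition _ :=
  GRing.isMonoidMorphism.Build Q C fq quot_lift_monoid_morphism.
HB.instance Definition _ :=
  GRing.isScalable.Build k Q C *:%R fq quot_lift_scalable.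

End Lift.
End QuotientAlgebra.

Section Relations.
Variables (k : fieldType) (a1 a2 a3 : k).

Section Defs.
Variables (A : algType k) (x : 'I_4 -> A).

Definition relA (a : k) (i j l : 'I_4) : A :=
  (x 0 * x i - x i * x 0) - a *: (x j * x l + x l * x j).

Definition relB (i j l : 'I_4) : A :=
  (x 0 * x i + x i * x 0) - (x j * x l - x l * x j).

(* x stands for the family of generators in any algebra that contains them:
   the free algebra for Q_rels, Q for B_rels *)
Definition Q_rels : seq A :=
  [:: relA a1 1 2 3; relA a2 2 3 1; relA a3 3 1 2;
      relB 1 2 3; relB 2 3 1; relB 3 1 2].

Definition Omega : A := - x 0 ^+ 2 + x 1 ^+ 2 + x 2 ^+ 2 + x 3 ^+ 2.

Definition Omega' : A :=
  x 1 ^+ 2 + ((1 + a1) / (1 - a2)) *: x 2 ^+ 2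
           + ((1 - a1) / (1 + a3)) *: x 3 ^+ 2.

Definition B_rels : seq A := [:: Omega; Omega'].

End Defs.

Lemma Q_rels_morph (A C : algType k) (f : {lrmorphism A -> C}) x :
  map f (Q_rels x) = Q_rels (f \o x).
Proof.
have hA a i j l : f (relA x a i j l) = relA (f \o x) a i j l.
  by rewrite /relA (linearB f) (linearZ_LR f) /= rmorphB rmorphD !rmorphM.
have hB i j l : f (relB x i j l) = relB (f \o x) i j l.
  by rewrite /relB !(rmorphB, rmorphD, rmorphM).
by rewrite /= !hA !hB.
Qed.

Lemma B_rels_morph (A C : algType k) (f : {lrmorphism A -> C}) x :
  map f (B_rels x) = B_rels (f \o x).
Proof.
rewrite /= /Omega /Omega' !(linearD f) (linearN f) !(linearZ_LR f) /=.
by rewrite !rmorphXn.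
Qed.

Lemma Q_rels0 (A : algType k) : {in Q_rels (fun=> 0 : A), forall z, z = 0}.
Proof.
have hA a i j l : relA (fun=> 0 : A) a i j l = 0.
  by rewrite /relA !mul0r subr0 addr0 scaler0 subr0.
have hB i j l : relB (fun=> 0 : A) i j l = 0.
  by rewrite /relB !mul0r !subr0 addr0.
by move=> z; rewrite /Q_rels !hA !hB !inE !orbb => /eqP.
Qed.

Lemma B_rels0 (A : algType k) : {in B_rels (fun=> 0 : A), forall z, z = 0}.
Proof.
have h : Omega (fun=> 0 : A) = 0 by rewrite /Omega expr0n oppr0 !addr0.
have h' : Omega' (fun=> 0 : A) = 0.
  by rewrite /Omega' expr0n !scaler0 !addr0.
by move=> z; rewrite /B_rels h h' !inE !orbb => /eqP.
Qed.

Local Notation F := (free_alg k 4).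
Local Notation X := (@free_gen k 4).

Lemma free_lift_Q_rels (A : algType k) (x : 'I_4 -> A) :
    {in Q_rels x, forall z, z = 0} ->
  {in Q_rels X, forall z, free_lift x z = 0}.
Proof.
move=> x0 z /(map_f (free_lift x)); rewrite Q_rels_morph.
have -> : free_lift x \o X = x by apply/funext => j; apply: free_lift_gen.
exact: x0.
Qed.

Lemma Q_proper : ~ ideal_gen (Q_rels X) 1.
Proof.
move/(ideal_gen_morph (free_lift_Q_rels (@Q_rels0 k^o)))/eqP.
by rewrite rmorph1 oner_eq0.
Qed.

Definition Q : algType k := quot_alg Q_proper.

Definition xQ (j : 'I_4) : Q := quot_pi Q_proper (X j).

Lemma Q_rels_xQ : {in Q_rels xQ, forall z, z = 0}.
Proof.
move=> z; rewrite -[Q_rels xQ](Q_rels_morph (quot_pi Q_proper) X).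
by case/mapP => w wr ->; apply/quot_pi_eq0/IdealGen.
Qed.

Section QLift.
Variables (A : algType k) (x : 'I_4 -> A).
Hypothesis x0 : {in Q_rels x, forall z, z = 0}.

Definition Q_lift : {lrmorphism Q -> A} :=
  @quot_lift _ _ _ Q_proper _ _ (free_lift_Q_rels x0).

Lemma Q_lift_xQ j : Q_lift (xQ j) = x j.
Proof. rewrite -[RHS](free_lift_gen x); exact: quot_lift_pi. Qed.

Lemma Q_lift_B_rels :
    {in B_rels x, forall z, z = 0} ->
  {in B_rels xQ, forall z, Q_lift z = 0}.
Proof.
move=> x0' z /(map_f Q_lift); rewrite B_rels_morph.
have -> : Q_lift \o xQ = x by apply/funext => j; apply: Q_lift_xQ.
exact: x0'.
Qed.
End QLift.

Lemma Q_ext (A : algType k) (f g : {lrmorphism Q -> A}) :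
  (forall j, f (xQ j) = g (xQ j)) -> f =1 g.
Proof.
move=> fg; elim/quot_ind => z.
exact: (free_alg_ext (f := f \o quot_pi Q_proper) (g := g \o quot_pi Q_proper)).
Qed.

Lemma B_proper : ~ ideal_gen (B_rels xQ) 1.
Proof.
move/(ideal_gen_morph (Q_lift_B_rels (@Q_rels0 k^o) (@B_rels0 k^o)))/eqP.
by rewrite rmorph1 oner_eq0.
Qed.

Definition B : algType k := quot_alg B_proper.

Definition xB (j : 'I_4) : B := quot_pi B_proper (xQ j).

Lemma Q_rels_xB : {in Q_rels xB, forall z, z = 0}.
Proof.
move=> z; rewrite -[Q_rels xB](Q_rels_morph (quot_pi B_proper) xQ).
by case/mapP => w wr ->; rewrite (Q_rels_xQ wr) rmorph0.
Qed.

Lemma B_rels_xB : {in B_rels xB, forall z, z = 0}.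
Proof.
move=> z; rewrite -[B_rels xB](B_rels_morph (quot_pi B_proper) xQ).
by case/mapP => w wr ->; apply/quot_pi_eq0/IdealGen.
Qed.

Section BLift.
Variables (A : algType k) (x : 'I_4 -> A).
Hypothesis xQ0 : {in Q_rels x, forall z, z = 0}.
Hypothesis xB0 : {in B_rels x, forall z, z = 0}.

Definition B_lift : {lrmorphism B -> A} :=
  @quot_lift _ _ _ B_proper _ _ (Q_lift_B_rels xQ0 xB0).

Lemma B_lift_xB j : B_lift (xB j) = x j.
Proof. rewrite -[RHS](Q_lift_xQ xQ0); exact: quot_lift_pi. Qed.
End BLift.

Lemma B_ext (A : algType k) (f g : {lrmorphism B -> A}) :
  (forall j, f (xB j) = g (xB j)) -> f =1 g.
Proof.
move=> fg; elim/quot_ind => z.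
exact: (Q_ext (f := f \o quot_pi B_proper) (g := g \o quot_pi B_proper)).
Qed.

End Relations.

Definition Gamma : finGroupType := ('Z_2 * 'Z_2)%type.

Definition gamma1 : Gamma := (1, 0).
Definition gamma2 : Gamma := (0, 1).
Definition gamma3 : Gamma := (gamma1 * gamma2)%g.

(* gamma_i |-> i, the identity having index 0 *)
Definition gidx (g : Gamma) : 'I_4 :=
  if g == gamma1 then 1 else if g == gamma2 then 2
  else if g == gamma3 then 3 else 0.

Lemma Gamma_ind (P : Gamma -> Prop) :
  P 1%g -> P gamma1 -> P gamma2 -> P gamma3 -> forall g, P g.
Proof.
move=> P0 P1 P2 P3 [[[|[|//]] i] [[|[|//]] j]].
- by move: P0; congr (P _); apply/eqP.
- by move: P2; congr (P _); apply/eqP.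
- by move: P1; congr (P _); apply/eqP.
- by move: P3; congr (P _); apply/eqP.
Qed.

Lemma I4_ind (P : 'I_4 -> Prop) : P 0 -> P 1 -> P 2 -> P 3 -> forall j, P j.
Proof.
move=> P0 P1 P2 P3 [[|[|[|[|//]]]] i].
- by move: P0; congr (P _); apply: val_inj.
- by move: P1; congr (P _); apply: val_inj.
- by move: P2; congr (P _); apply: val_inj.
- by move: P3; congr (P _); apply: val_inj.
Qed.

Section GammaAction.
Variables (k : fieldType) (a1 a2 a3 : k).

Definition gsign (g : Gamma) (j : 'I_4) : k :=
  if [|| g == 1%g, j == 0 | j == gidx g] then 1 else -1.

Lemma gsign1 j : gsign 1%g j = 1.
Proof. by []. Qed.

Lemma gsignM g h j : gsign (g * h)%g j = gsign g j * gsign h j.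
Proof.
by elim/Gamma_ind: g; elim/Gamma_ind: h; elim/I4_ind: j;
  rewrite /gsign /= ?mulrNN ?mulr1 ?mul1r.
Qed.

Lemma gsign_cycl g (i j l : 'I_4) :
  (i, j, l) \in [:: (1, 2, 3); (2, 3, 1); (3, 1, 2)] ->
  gsign g j * gsign g l = gsign g i.
Proof.
by rewrite !inE => /or3P[] /eqP[-> -> ->]; elim/Gamma_ind: g;
  rewrite /gsign /= ?mulrNN ?mulr1 ?mul1r.
Qed.

Lemma gsign0 g : gsign g 0 = 1.
Proof. by rewrite /gsign eqxx orbT. Qed.

Lemma gsignK g j : gsign g j * gsign g j = 1.
Proof. by rewrite /gsign; case: ifP; rewrite ?mulrNN mulr1. Qed.

Definition gtwist (A : algType k) (x : 'I_4 -> A) g j : A := gsign g j *: x j.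

Lemma gtwist_Q_rels (A : algType k) (x : 'I_4 -> A) g :
    {in Q_rels a1 a2 a3 x, forall z, z = 0} ->
  {in Q_rels a1 a2 a3 (gtwist x g), forall z, z = 0}.
Proof.
move=> x0.
have cyc (i j l : 'I_4) :
  (i, j, l) \in [:: (1, 2, 3); (2, 3, 1); (3, 1, 2) : 'I_4 * 'I_4 * 'I_4] ->
  gsign g j * gsign g l = gsign g i /\ gsign g l * gsign g j = gsign g i.
  by move=> /(gsign_cycl g) E; rewrite [in X in _ /\ X]mulrC.
have hA a i j l : (i, j, l) \in [:: (1, 2, 3); (2, 3, 1); (3, 1, 2)] ->
    relA (gtwist x g) a i j l = gsign g i *: relA x a i j l.
  move=> /cyc[E1 E2]; rewrite /relA /gtwist gsign0 scale1r.
  rewrite -!scalerAl -!scalerAr !scalerA E1 E2.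
  by rewrite -(scalerDr (gsign g i)) scalerA (mulrC a) -scalerA -!scalerBr.
have hB i j l : (i, j, l) \in [:: (1, 2, 3); (2, 3, 1); (3, 1, 2)] ->
    relB (gtwist x g) i j l = gsign g i *: relB x i j l.
  move=> /cyc[E1 E2]; rewrite /relB /gtwist gsign0 scale1r.
  rewrite -!scalerAl -!scalerAr !scalerA E1 E2.
  by rewrite -(scalerDr (gsign g i)) -!scalerBr.
move=> z; rewrite {1}/Q_rels !inE.
case/or4P=> [|||/or3P[]] /eqP ->; rewrite ?hA ?hB //;
  by rewrite [X in _ *: X]x0 ?scaler0 // !inE eqxx ?orbT.
Qed.

Lemma gtwist_B_rels (A : algType k) (x : 'I_4 -> A) g :
  B_rels a1 a2 a3 (gtwist x g) = B_rels a1 a2 a3 x.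
Proof.
have sq j : gtwist x g j ^+ 2 = x j ^+ 2.
  by rewrite !expr2 /gtwist -scalerAl -scalerAr scalerA gsignK scale1r.
by rewrite /B_rels /Omega /Omega' !sq.
Qed.

Local Notation B := (B a1 a2 a3).
Local Notation xB := (xB a1 a2 a3).

Lemma B_act_rels g : {in B_rels a1 a2 a3 (gtwist xB g), forall z, z = 0}.
Proof. by rewrite gtwist_B_rels; apply: B_rels_xB. Qed.

Definition B_act (g : Gamma) : {lrmorphism B -> B} :=
  B_lift (gtwist_Q_rels (g := g) (@Q_rels_xB k a1 a2 a3)) (@B_act_rels g).

Lemma B_act_xB g j : B_act g (xB j) = gsign g j *: xB j.
Proof. exact: B_lift_xB. Qed.

Lemma B_act1 : B_act 1%g =1 id.
Proof.
apply: (B_ext (g := idfun)) => j.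
by rewrite B_act_xB gsign1 scale1r.
Qed.

Lemma B_actM g h u : B_act (g * h)%g u = B_act g (B_act h u).
Proof.
apply: (B_ext (f := B_act (g * h)%g) (g := B_act g \o B_act h)) => j.
rewrite [LHS]B_act_xB gsignM.
transitivity (B_act g (gsign h j *: xB j)).
  transitivity (gsign h j *: B_act g (xB j)).
    by rewrite B_act_xB scalerA mulrC.
  exact/esym/(linearZ_LR (B_act g)).
by congr (B_act g _); rewrite -B_act_xB.
Qed.

End GammaAction.

Section Tensor.
Variables (k : fieldType) (A : algType k) (n : nat).

(* M_n(A) is the tensor product of A and M_n(k) over k, b (x) m being the
   matrix of the m i j *: b; see tensmxM and tensmx_universal. *)
Definition tensmx (b : A) (m : 'M[k]_n) : 'M[A]_n :=
  map_mx (fun c => c *: b) m.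

Lemma tensmxDl m : {morph tensmx^~ m : b b' / b + b'}.
Proof. by move=> b b'; apply/matrixP=> i j; rewrite !mxE scalerDr. Qed.

Lemma tensmxDr b : {morph tensmx b : m m' / m + m'}.
Proof. by move=> m m'; apply/matrixP=> i j; rewrite !mxE scalerDl. Qed.

Lemma tensmxZ c b m : tensmx (c *: b) m = tensmx b (c *: m).
Proof. by apply/matrixP=> i j; rewrite !mxE scalerA mulrC. Qed.

Lemma tensmxM b m b' m' : tensmx b m *m tensmx b' m' = tensmx (b * b') (m *m m').
Proof.
apply/matrixP=> i j; rewrite !mxE scaler_suml; apply: eq_bigr => l _.
by rewrite !mxE -scalerAl -scalerAr scalerA.
Qed.

Lemma tensmxE (M : 'M[A]_n) :
  M = \sum_i \sum_j tensmx (M i j) (delta_mx i j).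
Proof.
rewrite [LHS]matrix_sum_delta.
by apply/eq_bigr => i _; apply/eq_bigr => j _; apply/matrixP => r s;
  rewrite !mxE; case: andP; rewrite ?mulr1 ?scale1r ?mulr0 ?scale0r.
Qed.

Lemma tensmx_universal (V : zmodType) (f : A -> 'M[k]_n -> V) :
    (forall m, {morph f^~ m : b b' / b + b'}) ->
    (forall b, {morph f b : m m' / m + m'}) ->
    (forall c b m, f (c *: b) m = f b (c *: m)) ->
  exists! F : 'M[A]_n -> V,
    {morph F : M N / M + N} /\ forall b m, F (tensmx b m) = f b m.
Proof.
move=> fDl fDr fZ.
have f0r b : f b 0 = 0 by apply: (addrI (f b 0)); rewrite -fDr !addr0.
pose F (M : 'M[A]_n) := \sum_i \sum_j f (M i j) (delta_mx i j).
have FD : {morph F : M N / M + N}.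
  move=> M N; rewrite /F -big_split; apply: eq_bigr => i _ /=.
  by rewrite -big_split; apply: eq_bigr => j _ /=; rewrite mxE fDl.
exists F; split; first split=> // b m.
  have fsum (I : finType) (G : I -> 'M[k]_n) : f b (\sum_i G i) = \sum_i f b (G i).
    exact: (big_morph (f b) (fDr b) (f0r b)).
  rewrite [m in RHS]matrix_sum_delta fsum; apply: eq_bigr => i _.
  by rewrite fsum; apply: eq_bigr => j _; rewrite mxE fZ.
move=> G [GD Gf]; apply/funext => M.
have G0 : G 0 = 0 by apply: (addrI (G 0)); rewrite -GD !addr0.
have Gsum (I : finType) (H : I -> 'M[A]_n) : G (\sum_i H i) = \sum_i G (H i).
  exact: (big_morph G GD G0).
rewrite [in RHS](tensmxE M) Gsum; apply: eq_bigr => i _.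
by rewrite Gsum; apply: eq_bigr => j _; rewrite Gf.
Qed.

End Tensor.

Section TensorAct.
Variables (k : fieldType) (A : algType k) (n : nat).

(* f (x) (conjugation by q), for f an endomorphism of the algebra A *)
Definition tensmx_act (f : {lrmorphism A -> A}) (q : 'M[k]_n.+1)
    (M : 'M[A]_n.+1) : 'M[A]_n.+1 :=
  tensmx 1 q * map_mx f M * tensmx 1 q^-1.

Variables (f : {lrmorphism A -> A}) (q : 'M[k]_n.+1).

Lemma tensmx_act_tens b m :
  tensmx_act f q (tensmx b m) = tensmx (f b) (q * m * q^-1).
Proof.
rewrite /tensmx_act.
have -> : map_mx f (tensmx b m) = tensmx (f b) m.
  by apply/matrixP=> r s; rewrite !mxE; apply: (linearZ_LR f).
by rewrite -!mulmxE !tensmxM mul1r mulr1.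
Qed.

Lemma tensmx11 : tensmx 1 1 = 1 :> 'M[A]_n.+1.
Proof.
by apply/matrixP=> r s; rewrite !mxE; case: (r == s); rewrite ?scale1r ?scale0r.
Qed.

Lemma tensmx_act_zmod_morphism : zmod_morphism (tensmx_act f q).
Proof. by move=> M N; rewrite /tensmx_act rmorphB mulrBr mulrBl. Qed.

Lemma tensmx_act_monoid_morphism :
  q \is a GRing.unit -> monoid_morphism (tensmx_act f q).
Proof.
move=> qU; rewrite /tensmx_act.
have U : tensmx 1 q^-1 * tensmx 1 q = 1 :> 'M[A]_n.+1.
  by rewrite -mulmxE tensmxM mulr1 mulmxE mulVr // tensmx11.
have V : tensmx 1 q * tensmx 1 q^-1 = 1 :> 'M[A]_n.+1.
  by rewrite -mulmxE tensmxM mulr1 mulmxE mulrV // tensmx11.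
split=> [|M N]; first by rewrite rmorph1 mulr1.
by rewrite rmorphM !mulrA -[_ * _ * tensmx _ q in RHS]mulrA U mulr1.
Qed.

Lemma tensmx_act_eigen b m (e : k) :
    f b = e *: b -> q * m = e *: (m * q) -> e * e = 1 -> q \is a GRing.unit ->
  tensmx_act f q (tensmx b m) = tensmx b m.
Proof.
move=> fb qm ee qU; rewrite tensmx_act_tens fb qm tensmxZ -mulmxE -scalemxAl.
by rewrite scalerA ee scale1r mulmxE mulrK.
Qed.

End TensorAct.

Section Qmatrices.
Variables (k : fieldType) (i : k).

Definition mx22 (a b c d : k) : 'M[k]_2 :=
  \matrix_(r, s) (if r == 0 then (if s == 0 then a else b)
                  else (if s == 0 then c else d)).

(* q_0 = 1, so that the tensor of x_j and q_j is y_j for all j in 'I_4 *)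
Definition qmx (j : 'I_4) : 'M[k]_2 :=
  if j == 1 then mx22 i 0 0 (- i)
  else if j == 2 then mx22 0 i i 0
  else if j == 3 then mx22 0 (-1) 1 0
  else 1.

Lemma mx22M a b c d a' b' c' d' :
  mx22 a b c d * mx22 a' b' c' d' =
  mx22 (a * a' + b * c') (a * b' + b * d') (c * a' + d * c') (c * b' + d * d').
Proof.
apply/matrixP=> r s; rewrite !mxE !big_ord_recl big_ord0 !mxE /= addr0.
by case: (r == 0); case: (s == 0).
Qed.

Lemma mx22Z e a b c d : e *: mx22 a b c d = mx22 (e * a) (e * b) (e * c) (e * d).
Proof.
by apply/matrixP=> r s; rewrite !mxE; case: (r == 0); case: (s == 0).
Qed.

Lemma mx22_1 : 1 = mx22 1 0 0 1.
Proof.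
by apply/matrixP=> -[[|[|//]] r] [[|[|//]] s]; rewrite !mxE.
Qed.

Hypothesis hi : i ^+ 2 = -1.

Lemma qmx_unit j : qmx j \is a GRing.unit.
Proof.
have ii : i * i = -1 by rewrite -expr2.
have U (q : 'M[k]_2) : q * (-1 *: q) = 1 -> q \is a GRing.unit.
  move=> E; apply/unitrP; exists (-1 *: q); split => //.
  by rewrite -scalerAl scalerAr.
elim/I4_ind: j; first exact: unitr1.
all: apply: U; rewrite /qmx /= mx22Z mx22M mx22_1.
all: by rewrite !(mul0r, mulr0, mulN1r, mulr1, mul1r, mulrN, mulNr, opprK, oppr0, addr0, add0r, ii).
Qed.

Lemma qmxC g j :
  qmx (gidx g) * qmx j = gsign k g j *: (qmx j * qmx (gidx g)).
Proof.
have ii : i * i = -1 by rewrite -expr2.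
elim/Gamma_ind: g; elim/I4_ind: j; rewrite /gsign /qmx /= ?mx22_1 ?mx22M ?mx22Z;
by rewrite ?(mul0r, mulr0, mulN1r, mulr1, mul1r, mulrN, mulNr, opprK, oppr0, addr0, add0r, ii).
Qed.

End Qmatrices.

Section Btilde.
Variables (k : fieldType) (a1 a2 a3 i : k).
Local Notation B := (B a1 a2 a3).
Local Notation MB := 'M[B]_2.

Definition MB_act (g : Gamma) (M : MB) : MB :=
  tensmx_act (B_act a1 a2 a3 g) (qmx i (gidx g)) M.

Definition MB_fixed : {pred MB} := fun M => [forall g, MB_act g M == M].

Hypothesis hi : i ^+ 2 = -1.

Lemma MB_fixed_subring_closed : subring_closed MB_fixed.
Proof.
have A1 g : MB_act g 1 = 1.
  exact: (tensmx_act_monoid_morphism _ (qmx_unit hi _)).1.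
have AB g M N : MB_act g (M - N) = MB_act g M - MB_act g N.
  exact: tensmx_act_zmod_morphism.
have AM g M N : MB_act g (M * N) = MB_act g M * MB_act g N.
  exact: (tensmx_act_monoid_morphism _ (qmx_unit hi _)).2.
split=> [|M N /forallP HM /forallP HN|M N /forallP HM /forallP HN].
- by apply/forallP => g; rewrite A1.
- by apply/forallP => g; rewrite AB (eqP (HM g)) (eqP (HN g)).
- by apply/forallP => g; rewrite AM (eqP (HM g)) (eqP (HN g)).
Qed.

(* hi is only recorded so that the subring structure can be inferred *)
Definition Btilde_pred of i ^+ 2 = -1 : {pred MB} := MB_fixed.

HB.instance Definition _ :=
  GRing.isSubringClosed.Build MB (Btilde_pred hi) MB_fixed_subring_closed.

Definition Btilde := {M : MB | Btilde_pred hi M}.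

HB.instance Definition _ := SubChoice.on Btilde.
HB.instance Definition _ := [SubChoice_isSubNzRing of Btilde by <:].

Lemma yB_subproof j : Btilde_pred hi (tensmx (xB a1 a2 a3 j) (qmx i j)).
Proof.
apply/forallP => g; apply/eqP.
exact: (tensmx_act_eigen (B_act_xB a1 a2 a3 g j) (qmxC hi g j)
  (gsignK k g j) (qmx_unit hi _)).
Qed.

Definition yB (j : 'I_4) : Btilde := Sub _ (yB_subproof j).

End Btilde.

(* Main.v *)
(* The quaternion relations [q_j q_l = - q_l q_j = q_m] turn the second family
   of relations of Q into [{y_0, y_m} = {y_j, y_l}] for [(m, j, l)] cyclic, while
   [q_j^2 = -1] turns [Omega] into [- \sum_j y_j^2].  Hence
   [(y_0 + e_1 y_1 + e_2 y_2 + e_3 y_3)^2 = 0] for signs with [e_1 e_2 e_3 = -1].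
   These elements are nonzero because the relations of B are quadratic: any
   assignment of the [x_j] in a square-zero ideal extends to B. *)
Require Import Defs.
From mathcomp Require Import all_fingroup.
From mathcomp Require Import all_boot all_order all_algebra.
From mathcomp Require Import ssrAC.

Set Implicit Arguments.
Unset Strict Implicit.
Unset Printing Implicit Defensive.

Import GRing.Theory.
Local Open Scope ring_scope.

(** In the expanded square, the anticommutators of [y0] with the other three carry a minus sign and
    those among [y1], [y2], [y3] a plus sign. The hypotheses cancel them in pairs, leaving the sum
    of squares. *)
Lemma sqr_signed_sum4_eq0 (R : pzRingType) (y0 y1 y2 y3 : R) :
    y0 ^+ 2 + y1 ^+ 2 + y2 ^+ 2 + y3 ^+ 2 = 0 ->
    y0 * y1 + y1 * y0 = y2 * y3 + y3 * y2 ->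
    y0 * y2 + y2 * y0 = y3 * y1 + y1 * y3 ->
    y0 * y3 + y3 * y0 = y1 * y2 + y2 * y1 ->
  (y0 - y1 - y2 - y3) ^+ 2 = 0.
Proof.
move=> sq0 h1 h2 h3.
pose c (u v : R) := u * v + v * u.
have cC u v : c u v = c v u by rewrite /c addrC.
have cDr u v w : c u (v + w) = c u v + c u w by rewrite /c mulrDr mulrDl addrACA.
have cN u v : c u (- v) = - c u v by rewrite /c mulrN mulNr opprD.
have sqrD (u v : R) : (u + v) ^+ 2 = u ^+ 2 + v ^+ 2 + c u v.
  by rewrite !expr2 mulrDl !mulrDr (AC (2*2) (1*4*(2*3))).
have -> : y0 - y1 - y2 - y3 = y0 + - (y1 + y2 + y3) by rewrite !opprD !addrA.
rewrite sqrD sqrrN !sqrD cN !cDr [c (_ + _) _]cC cDr.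
rewrite (h1 : c y0 y1 = c y2 y3) (h2 : c y0 y2 = c y3 y1) (h3 : c y0 y3 = c y1 y2).
apply/eqP; rewrite subr_eq0; apply/eqP.
(* The permutation gathers the four squares in front, for [sq0], and lists the six mixed products in
   the order of the right-hand side. *)
by rewrite /c !addrA (ACl (1*2*3*6*10*9*7*8*4*5)) /= sq0 add0r.
Qed.

Lemma tensmxN (k : fieldType) (A : algType k) n (b : A) (m : 'M[k]_n) :
  tensmx b (- m) = tensmx (- b) m.
Proof. by apply/matrixP => r s; rewrite !mxE scaleNr scalerN. Qed.

Lemma tensmx0l (k : fieldType) (A : algType k) n (m : 'M[k]_n) :
  tensmx (0 : A) m = 0.
Proof. by apply/matrixP => r s; rewrite !mxE scaler0. Qed.

Section QuaternionTwist.
Variables (k : fieldType) (i : k) (hi : i ^+ 2 = -1).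
Variables (A : algType k) (a1 a2 a3 : k) (x : 'I_4 -> A).
Local Notation q := (qmx i).
Local Notation Y j := (tensmx (x j) (q j) : 'M[A]_2).

Lemma tensmx_mulr j l :
  tensmx (x j) (q j) * tensmx (x l) (q l) = tensmx (x j * x l) (q j * q l).
Proof. by rewrite -!mulmxE tensmxM. Qed.

Lemma qmx_sqr (j : 'I_4) : j != 0 -> q j * q j = - 1.
Proof.
have ii : i * i = -1 by rewrite -expr2.
rewrite mx22_1 -scaleN1r mx22Z.
elim/I4_ind: j => //= _; rewrite /qmx /= mx22M;
by rewrite !(mul0r, mulr0, mulN1r, mulr1, mul1r, mulrN, mulNr,
  opprK, oppr0, addr0, add0r, ii).
Qed.

Lemma qmx_cycl (j l m : 'I_4) :
    (j, l, m) \in [:: (1, 2, 3); (2, 3, 1); (3, 1, 2)] ->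
  q l * q m = q j /\ q m * q l = - q j.
Proof.
have ii : i * i = -1 by rewrite -expr2.
rewrite !inE => /or3P[] /eqP[-> -> ->]; rewrite -scaleN1r /qmx /= !mx22M mx22Z;
by rewrite !(mul0r, mulr0, mulN1r, mulr1, mul1r, mulrN, mulNr,
  opprK, oppr0, addr0, add0r, ii).
Qed.

Lemma tensmx_sum_sqr : Omega x = 0 ->
  Y 0 ^+ 2 + Y 1 ^+ 2 + Y 2 ^+ 2 + Y 3 ^+ 2 = 0.
Proof.
move=> Om; have q00 : q 0 * q 0 = 1 by rewrite mulr1.
(* All four squares have second factor [1] up to sign; with the signs moved to the first factors,
   these add up to [- Omega x]. *)
rewrite !expr2 !tensmx_mulr q00 !qmx_sqr // !tensmxN -!tensmxDl.
have -> : x 0 * x 0 - x 1 * x 1 - x 2 * x 2 - x 3 * x 3 = - Omega x.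
  by rewrite /Omega !expr2 !opprD opprK.
by rewrite Om oppr0 tensmx0l.
Qed.

(** As [q l] and [q m] anticommute, the commutator of [x l] and [x m] in [relB] becomes an
    anticommutator of tensors, with common second factor [q j]. *)
Lemma tensmx_anticomm (j l m : 'I_4) : relB x j l m = 0 ->
    (j, l, m) \in [:: (1, 2, 3); (2, 3, 1); (3, 1, 2)] ->
  Y 0 * Y j + Y j * Y 0 = Y l * Y m + Y m * Y l.
Proof.
move/eqP; rewrite subr_eq0 => /eqP rel /qmx_cycl[qlm qml].
have q0j : q 0 * q j = q j by rewrite mul1r.
have qj0 : q j * q 0 = q j by rewrite mulr1.
by rewrite !tensmx_mulr q0j qj0 qlm qml tensmxN -!tensmxDl rel.
Qed.

(** The matrices [q 2] and [q 3] have zero diagonal. This one entry reduces nonvanishing in the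
    matrix ring to nonvanishing in [A]. *)
Lemma tensmx_sub3_corner : (Y 0 - Y 1 - Y 2 - Y 3) 0 0 = x 0 - i *: x 1.
Proof. by rewrite !mxE /= !scale0r !subr0 scale1r. Qed.

Hypothesis xQ0 : {in Q_rels a1 a2 a3 x, forall z, z = 0}.
Hypothesis xB0 : {in B_rels a1 a2 a3 x, forall z, z = 0}.

Lemma tensmx_null_squares :
  [/\ Y 0 ^+ 2 + Y 1 ^+ 2 + Y 2 ^+ 2 + Y 3 ^+ 2 = 0,
      (Y 0 - Y 1 - Y 2 - Y 3) ^+ 2 = 0,
      (Y 0 - Y 1 + Y 2 + Y 3) ^+ 2 = 0,
      (Y 0 + Y 1 - Y 2 + Y 3) ^+ 2 = 0
    & (Y 0 + Y 1 + Y 2 - Y 3) ^+ 2 = 0].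
Proof.
have sq : Y 0 ^+ 2 + Y 1 ^+ 2 + Y 2 ^+ 2 + Y 3 ^+ 2 = 0.
  by apply: tensmx_sum_sqr; apply: xB0; rewrite inE eqxx.
have h1 : Y 0 * Y 1 + Y 1 * Y 0 = Y 2 * Y 3 + Y 3 * Y 2.
  by apply: tensmx_anticomm => //; apply: xQ0; rewrite !inE eqxx !orbT.
have h2 : Y 0 * Y 2 + Y 2 * Y 0 = Y 3 * Y 1 + Y 1 * Y 3.
  by apply: tensmx_anticomm => //; apply: xQ0; rewrite !inE eqxx !orbT.
have h3 : Y 0 * Y 3 + Y 3 * Y 0 = Y 1 * Y 2 + Y 2 * Y 1.
  by apply: tensmx_anticomm => //; apply: xQ0; rewrite !inE eqxx !orbT.
move: (Y 0) (Y 1) (Y 2) (Y 3) sq h1 h2 h3 => y0 y1 y2 y3 sq h1 h2 h3.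
split=> //.
- exact: sqr_signed_sum4_eq0.
(* Negating two of [y1], [y2], [y3] keeps the squares and changes both sides of each anticommutator
   relation by the same sign, so the first case applies again. *)
- rewrite -[y2]opprK -[y3]opprK; apply: sqr_signed_sum4_eq0;
  by rewrite ?sqrrN // !(mulrN, mulNr) ?opprK -?opprD ?h1 ?h2 ?h3.
- rewrite -[y1]opprK -[y3]opprK; apply: sqr_signed_sum4_eq0;
  by rewrite ?sqrrN // !(mulrN, mulNr) ?opprK -?opprD ?h1 ?h2 ?h3.
- rewrite -[y1]opprK -[y2]opprK; apply: sqr_signed_sum4_eq0;
  by rewrite ?sqrrN // !(mulrN, mulNr) ?opprK -?opprD ?h1 ?h2 ?h3.
Qed.

End QuaternionTwist.

Section Btilde.
Variables (k : fieldType) (a1 a2 a3 i : k) (hi : i ^+ 2 = -1).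
Local Notation y := (yB a1 a2 a3 hi).
Local Notation x := (xB a1 a2 a3).

Lemma xB_lin_neq0 (c : k) : x 0 - c *: x 1 != 0.
Proof.
(* The nilpotent [delta_mx 0 1] makes all products of values vanish, so every quadratic relation
   holds, while [x 0 - c *: x 1] is sent to [v 0], which is nonzero. *)
pose v (j : 'I_4) : 'M[k]_2 := if j == 0 then delta_mx 0 1 else 0.
have vv j l : v j * v l = 0.
  by rewrite /v; do 2![case: ifP => _]; rewrite ?mulr0 ?mul0r // -mulmxE mul_delta_mx_0.
have vQ : {in Q_rels a1 a2 a3 v, forall z, z = 0}.
  move=> z; rewrite /Q_rels /relA /relB !vv !(addr0, subr0, scaler0) !inE !orbb.
  by move/eqP.
have vB : {in B_rels a1 a2 a3 v, forall z, z = 0}.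
  move=> z; rewrite /B_rels /Omega /Omega' !expr2 !vv !(oppr0, addr0, scaler0).
  by rewrite !inE !orbb => /eqP.
pose f := B_lift vQ vB.
have fE : f (x 0 - c *: x 1) = v 0.
  have fx j : f (x j) = v j := B_lift_xB vQ vB j.
  have fZ : f (c *: x 1) = c *: f (x 1) := linearZ_LR f c (x 1).
  have fB : f (x 0 - c *: x 1) = f (x 0) - f (c *: x 1) := rmorphB f _ _.
  by rewrite fB fZ !fx [v 1]/v /= scaler0 subr0.
apply/eqP => x01; move: fE; rewrite x01 rmorph0 => /matrixP/(_ 0 1)/eqP.
by rewrite !mxE !eqxx eq_sym oner_eq0.
Qed.

Lemma val_BtildeB :
  {morph val : u v / u - v : Btilde a1 a2 a3 hi >-> u - v}.
Proof. exact: rmorphB. Qed.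

Lemma yB_sub3_neq0 : y 0 - y 1 - y 2 - y 3 != 0.
Proof.
apply: contra (xB_lin_neq0 i) => /eqP y0; apply/eqP.
rewrite -(tensmx_sub3_corner i); move/(congr1 val): y0; rewrite !val_BtildeB /= => ->.
exact: mxE.
Qed.

End Btilde.

Theorem proposition8p12 (k : closedFieldType) (hk : 2%N \notin [pchar k])
    (a1 a2 a3 : k)
    (ha : a1 + a2 + a3 + a1 * a2 * a3 = 0)
    (ha' : {in [:: a1; a2; a3], forall a, a \notin [:: 0; 1; -1]})
    (i : k) (hi : i ^+ 2 = -1) :
  let y := yB a1 a2 a3 hi in
  ~ GRing.integral_domain_axiom (Btilde a1 a2 a3 hi) /\
  [/\ y 0 ^+ 2 + y 1 ^+ 2 + y 2 ^+ 2 + y 3 ^+ 2 = 0,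
      (y 0 - y 1 - y 2 - y 3) ^+ 2 = 0,
      (y 0 - y 1 + y 2 + y 3) ^+ 2 = 0,
      (y 0 + y 1 - y 2 + y 3) ^+ 2 = 0
    & (y 0 + y 1 + y 2 - y 3) ^+ 2 = 0].
Proof.
move=> y.
have [s0 s1 s2 s3 s4] :=
  tensmx_null_squares hi (@Q_rels_xB k a1 a2 a3) (@B_rels_xB k a1 a2 a3).
have valD : {morph val : u v / u + v : Btilde a1 a2 a3 hi >-> u + v} :=
  rmorphD _.
have valX : {morph val : u / u ^+ 2 : Btilde a1 a2 a3 hi >-> u ^+ 2} :=
  fun u => rmorphXn _ 2 u.
have sq1 : (y 0 - y 1 - y 2 - y 3) ^+ 2 = 0.
  (* Identities in [Btilde] are checked in the matrix ring over [B], through the injective morphism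
     [val]. *)
  by apply: val_inj; rewrite valX !val_BtildeB; exact: s1.
split.
  (* A nonzero element of square zero is a zero divisor. *)
  move=> dom; move/eqP: sq1; rewrite expr2 => /eqP/dom.
  by rewrite orbb (negPf (yB_sub3_neq0 _ _ _ _)).
split=> //; apply: val_inj.
- by rewrite !valD !valX; exact: s0.
- by rewrite valX [val (_ + y 3)]valD [val (_ + y 2)]valD val_BtildeB; exact: s2.
- by rewrite valX [val (_ + y 3)]valD [val (_ - y 2)]val_BtildeB valD; exact: s3.
- by rewrite valX [val (_ - y 3)]val_BtildeB !valD; exact: s4.
Qed.
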